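(* There exists a uniquely ergodic t.d.s. with positive topological entropy that is not sensitive.
   Context: A t.d.s. (topological dynamical system) is a pair $(X,T)$ where $X$ is a non-empty compact metric space with metric $d$ and $T\colon X\to X$ is continuous; $\mathbb{N}$ denotes the positive integers. $(X,T)$ is uniquely ergodic if it has exactly one $T$-invariant Borel probability measure. $(X,T)$ is sensitive if there is $\delta>0$ such that for every non-empty open $U\subset X$ there exist $x,y\in U$ and $n\in\mathbb{N}$ with $d(T^nx,T^ny)>\delta$. *)

(* Defs.v *)
From HB Require Import structures.
From mathcomp Require Import all_boot all_order all_algebra.
From mathcomp Require Import all_classical all_reals all_analysis.

Set Implicit Arguments.
Unset Strict Implicit.
Unset Printing Implicit Defensive.

Import Order.TTheory GRing.Theory Num.Theory.
Import numFieldNormedType.Exports.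

Local Open Scope classical_set_scope.
Local Open Scope ring_scope.

(* The library's measurable types are pointed, so a Borel space is formed on a
   metric space with a distinguished point.  The point plays no other role than
   witnessing that the space is non-empty. *)
#[short(type="pmetricType")]
HB.structure Definition PMetric (R : numDomainType) :=
  { M of Metric R M & isPointed M }.

Definition tds (R : realType) (X : pmetricType R) (T : X -> X) : Prop :=
  compact [set: X] /\ continuous T.

Definition borel (R : realType) (X : pmetricType R) :=
  g_sigma_algebraType (@open X).

Definition invariant_measure (R : realType) (X : pmetricType R) (T : X -> X)
    (mu : probability (borel X) R) : Prop :=
  forall A : set (borel X), measurable A -> mu (T @^-1` A) = mu A.

(* A library measure is a function on all sets, with unconstrained values on
   the non-measurable ones: two measures are the same when they agree on the
   Borel sets. *)
Definition uniquely_ergodic (R : realType) (X : pmetricType R) (T : X -> X) :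
    Prop :=
  exists2 mu : probability (borel X) R, invariant_measure T mu &
    forall nu : probability (borel X) R, invariant_measure T nu ->
      forall A : set (borel X), measurable A -> nu A = mu A.

Definition sensitive (R : realType) (X : pmetricType R) (T : X -> X) : Prop :=
  exists2 delta : R, 0 < delta &
    forall U : set X, open U -> U !=set0 ->
      exists x y : X, exists n : nat,
        [/\ U x, U y, (0 < n)%N & delta < mdist (iter n T x) (iter n T y)].

(* Topological entropy in the sense of Adler, Konheim and McAndrew. *)

Definition is_cover (X : Type) (U : set (set X)) : Prop :=
  \bigcup_(A in U) A = [set: X].

Definition open_cover (X : topologicalType) (U : set (set X)) : Prop :=
  (forall A, U A -> open A) /\ is_cover U.

(* The least cardinality of a finite subcover of U. *)
Definition cover_number (R : realType) (X : Type) (U : set (set X)) : R :=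
  inf [set n%:R | n in [set n : nat | exists V : set (set X),
    [/\ V `<=` U, (V #= `I_n)%card & is_cover V]]].

(* The join of the covers T^-i U for i < n. *)
Definition iterated_join (X : Type) (T : X -> X) (U : set (set X)) (n : nat) :
    set (set X) :=
  [set \bigcap_(i in `I_n) (iter i T @^-1` V i) | V in
    [set V : nat -> set X | forall i, U (V i)]].

(* The limit exists for every open cover of a compact space, by
   subadditivity; the term for n = 0 is immaterial. *)
Definition cover_entropy (R : realType) (X : Type) (T : X -> X)
    (U : set (set X)) : R :=
  limn (fun n => n%:R^-1 * ln (cover_number R (iterated_join T U n))).

Definition topological_entropy (R : realType) (X : pmetricType R)
    (T : X -> X) : \bar R :=
  ereal_sup [set (cover_entropy R T U)%:E | U in @open_cover X].

(* Main.v *)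
Require Import Defs.
From HB Require Import structures.
From mathcomp Require Import all_boot all_order all_algebra.
From mathcomp Require Import all_classical all_reals all_analysis.
From mathcomp Require Import measurable_realfun ring lra zify.

(** The space is a one-sided subshift of Grillenberger together with one extra
    point.

    Words.  Start from the one-letter words over an alphabet with at least 32
    letters, and let the words of level k+1 be all the concatenations of the
    words of level k in which each of them occurs exactly once.  There are N!
    words of level k+1 when there are N of level k, and they are N times as
    long.  Since N! is at least (N/4)^N, passing to the next level costs only
    a factor 4 per word of level k in the count; the slack 2^4 in the bound
    2^(length + 4) pays for it, so that the bound holds at every level
    ([size_words_ge]).  Every word of every level begins a point of the
    system, and therefore the entropy is at least ln 2 ([shift_entropy_gt0]).

    Unique ergodicity.  All the words of level k+1 contain the same words of
    level k, up to order.  A pattern of length r thus occurs in all of them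
    the same number of times, except for the occurrences that straddle two
    consecutive words of level k, of which there are at most r per word
    ([occurrences_word]).  As every point is a concatenation of words of level
    k+1 after a short initial segment, the frequency of the pattern in a long
    window varies with the point by at most a quantity of order r divided by
    the length of the words of level k.  This determines the value of an
    invariant probability on the sets that depend on finitely many
    coordinates ([small_oscillation_unique]).  An invariant probability exists
    by the argument of Krylov and Bogolyubov: an ultrafilter limit of the
    visit frequencies of a point is an invariant, finitely additive
    probability, and by compactness it is countably additive on the clopen
    sets, hence extends to the Borel sets ([exists_invariant_probability]).

    No sensitivity.  The shift need not map the space onto itself.  A further
    letter, the star [None], is put in front of a single point of the
    subshift.  The resulting point is isolated, because no other point begins
    with a star, and a one-point open set contradicts sensitivity
    ([grillenberger_not_sensitive]).  The extra point still satisfies the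
    block condition that defines the subshift, with the offset increased by
    one, so the frequency estimate applies to it like to all the others. *)

Set Implicit Arguments.
Unset Strict Implicit.
Unset Printing Implicit Defensive.

(** * Words *)

Definition shift_seq (A : Type) (x : nat -> A) : nat -> A := fun n => x n.+1.

(** The binomial coefficient of 2n over n is at least n^n / n!, since each of
    the n factors of its numerator exceeds n, and at most 2^(2n). *)
Lemma expn_le_fact n : n ^ n <= 4 ^ n * n`!.
Proof.
have ffact_ge m : n ^ m <= (n + m) ^_ m.
  elim: m => [|m ih]; first by rewrite ffactn0.
  by rewrite addnS ffactnS expnS leq_mul// (leq_trans _ (leqnSn _))// leq_addr.
apply: leq_trans (ffact_ge n) _; rewrite -bin_ffact leq_mul2r; apply/orP; right.
rewrite (_ : 4 = 2 ^ 2)// -expnM mul2n -addnn -[2]/(1 + 1) expnDn.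
have h : n < (n + n).+1 by rewrite ltnS leq_addr.
by rewrite (bigD1 (Ordinal h))//= !exp1n !muln1 leq_addr.
Qed.

Section sequences.
Context (A : eqType).
Implicit Types (s t : seq (seq A)) (x : nat -> A).

Lemma size_flatten_const l s : {in s, forall v, size v = l} ->
  size (flatten s) = size s * l.
Proof.
elim: s => [//|v s ih] sl; rewrite /= size_cat mulSn sl ?mem_head// ih// => w ws.
by rewrite sl// inE ws orbT.
Qed.

Lemma flatten_const_inj l s t : size s = size t ->
  {in s, forall v, size v = l} -> {in t, forall v, size v = l} ->
  flatten s = flatten t -> s = t.
Proof.
move=> st sl tl /eq_from_flatten_shape; apply.
have shapeE u : {in u, forall v : seq A, size v = l} -> shape u = nseq (size u) l.
  move=> ul; rewrite /shape; elim: u ul => [//|v u ih] ul /=.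
  by rewrite ul ?mem_head// ih// => w wu; rewrite ul// inE wu orbT.
by rewrite !shapeE// st.
Qed.

Definition block x p l : seq A := mkseq (fun i => x (p + i)) l.

Lemma size_block x p l : size (block x p l) = l.
Proof. exact: size_mkseq. Qed.

Lemma block_add x p l m : block x p (l + m) = block x p l ++ block x (p + l) m.
Proof.
rewrite /block /mkseq iotaD map_cat; congr cat.
rewrite add0n -{1}(addn0 l) iotaDl -map_comp.
by apply: eq_map => i /=; rewrite addnA.
Qed.

Lemma block_flatten x p l s : {in s, forall v, size v = l} ->
  block x p (size s * l) = flatten s ->
  forall i, i < size s -> block x (p + i * l) l \in s.
Proof.
elim: s p => [//|v s ih] p sl; rewrite /= mulSn block_add => /eqP.
rewrite eqseq_cat ?size_block ?sl ?mem_head// => /andP[/eqP pv /eqP ps] [_|i].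
  by rewrite mul0n addn0 pv mem_head.
rewrite ltnS => si; rewrite mulSn addnA inE ih ?orbT// => w ws.
by rewrite sl// inE ws orbT.
Qed.

Lemma block_eq x y p l :
  (forall i, i < p + l -> x i = y i) -> block x p l = block y p l.
Proof.
move=> xy; apply/eq_in_map => i; rewrite mem_iota/= => il; apply: xy; lia.
Qed.

End sequences.

Section words.
Context (B : finType).
Local Notation A := (option B).

(** The letters of the words are the [Some b]; the extra letter [None] is
    kept for the isolated point. *)
Fixpoint words k : seq (seq A) :=
  if k is k'.+1 then [seq flatten s | s <- permutations (words k')]
  else [seq [:: Some b] | b <- enum B].

Fixpoint wlen k : nat := if k is k'.+1 then size (words k') * wlen k' else 1.

Lemma size_word k : {in words k, forall u, size u = wlen k}.
Proof.
elim: k => [|k ih] u; first by move=> /mapP[b _ ->].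
move=> /mapP[s]; rewrite mem_permutations => sW ->.
rewrite (@size_flatten_const _ (wlen k)) => [|v]; last first.
  by rewrite (perm_mem sW) => /ih.
by rewrite (perm_size sW).
Qed.

Lemma words_uniq k : uniq (words k).
Proof.
elim: k => [|k ih] /=.
  by rewrite map_inj_uniq ?enum_uniq// => a b [].
rewrite map_inj_in_uniq ?permutations_uniq// => s t.
rewrite !mem_permutations => sW tW; apply: (@flatten_const_inj _ (wlen k)).
- by rewrite (perm_size sW) (perm_size tW).
- by move=> v; rewrite (perm_mem sW); exact: size_word.
- by move=> v; rewrite (perm_mem tW); exact: size_word.
Qed.

Lemma size_wordsS k : size (words k.+1) = (size (words k))`!.
Proof. by rewrite /= size_map size_permutations// words_uniq. Qed.

Hypothesis B32 : 32 <= #|B|.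

(** The exponent exceeds the length by 4 to absorb the loss of a factor 4 per
    word in [expn_le_fact]: a level with N words leaves an excess of 2N in the
    next one. *)
Lemma size_words_ge k : 2 ^ (wlen k + 4) <= size (words k).
Proof.
elim: k => [|k ih]; first by rewrite /= size_map -cardE.
rewrite size_wordsS /=; set N := size _ in ih *; set l := wlen k in ih *.
rewrite -(@leq_pmul2l (4 ^ N)) ?expn_gt0//.
apply: leq_trans (expn_le_fact N).
have N16 : 16 <= N by apply: leq_trans ih; rewrite (@leq_exp2l 2 4)// leq_addl.
apply: (@leq_trans ((2 ^ (l + 4)) ^ N)); last by rewrite leq_exp2r//; lia.
by rewrite -[4 ^ N]/((2 ^ 2) ^ N) -!expnM -expnD leq_exp2l//; nia.
Qed.

Lemma size_words_gt1 k : 1 < size (words k).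
Proof.
by apply: leq_trans (size_words_ge k); rewrite (@leq_exp2l 2 1)// addnC.
Qed.

Lemma wlen_gt k : k < wlen k.
Proof. by elim: k => [//|k ih] /=; have := size_words_gt1 k; nia. Qed.

End words.

Section points.
Context (B : finType).
Hypothesis B32 : 32 <= #|B|.
Local Notation A := (option B).
Local Notation words := (words B).
Local Notation wlen := (wlen B).

Lemma wlen_gt0 k : 0 < wlen k.
Proof. exact: leq_ltn_trans (wlen_gt B32 k). Qed.

Lemma block_words (x : nat -> A) p k : block x p (wlen k.+1) \in words k.+1 ->
  forall i, i < size (words k) -> block x (p + i * wlen k) (wlen k) \in words k.
Proof.
move=> /mapP[s]; rewrite mem_permutations => sW bs i iW.
rewrite -(perm_mem sW); apply: block_flatten.
- by move=> v; rewrite (perm_mem sW); exact: size_word.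
- by rewrite (perm_size sW).
- by rewrite (perm_size sW).
Qed.

Lemma blocks_words_descend (x : nat -> A) k d c :
  (forall m, m < c ->
    block x (m * wlen (k + d)) (wlen (k + d)) \in words (k + d)) ->
  forall m, m.+1 * wlen k <= c * wlen (k + d) ->
    block x (m * wlen k) (wlen k) \in words k.
Proof.
elim: d c => [|d ih] c.
  by rewrite addn0 => H m; rewrite leq_pmul2r ?wlen_gt0//; exact: H.
rewrite addnS => H; rewrite /= mulnA; apply: ih => m.
have N0 : 0 < size (words (k + d)) by exact: ltnW (size_words_gt1 B32 _).
rewrite -ltn_divLR// => /H /block_words /(_ (m %% size (words (k + d)))).
by rewrite ltn_mod N0 /= mulnA -mulnDl -divn_eq; exact.
Qed.

(** A word of the next level that has u as a prefix. *)
Definition next_word k (u : seq A) : seq A := flatten (u :: rem u (words k)).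

Lemma next_word_in k u : u \in words k -> next_word k u \in words k.+1.
Proof.
by move=> uW; apply: map_f; rewrite mem_permutations perm_sym; exact: perm_to_rem.
Qed.

Fixpoint extend_word k (u : seq A) d : seq A :=
  if d is d'.+1 then next_word (k + d') (extend_word k u d') else u.

Lemma extend_word_in k u d :
  u \in words k -> extend_word k u d \in words (k + d).
Proof.
move=> uW; elim: d => [|d ih]; first by rewrite addn0.
by rewrite addnS; exact: next_word_in.
Qed.

Lemma nth_extend_word k u d d' i :
  u \in words k -> d <= d' -> i < wlen (k + d) ->
  nth None (extend_word k u d') i = nth None (extend_word k u d) i.
Proof.
move=> uW /subnKC <-; elim: (d' - d) => [|e ih] id; first by rewrite addn0.
rewrite addnS /= nth_cat (size_word (extend_word_in _ uW)) ih//.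
case: ifP => // /negP[]; apply: leq_trans id _.
elim: e {ih} => [|e ih]; first by rewrite addn0.
rewrite addnS addnS; apply: leq_trans ih _.
by rewrite /= leq_pmull// ltnW// size_words_gt1.
Qed.

(** The i-th extension of u has more than i letters, and so the default value
    of [nth] is never reached. *)
Definition word_limit k (u : seq A) : nat -> A :=
  fun i => nth None (extend_word k u i) i.

Lemma block_word_limit k u d : u \in words k ->
  block (word_limit k u) 0 (wlen (k + d)) = extend_word k u d.
Proof.
move=> uW; have sE := size_word (extend_word_in d uW).
apply: (@eq_from_nth _ None); first by rewrite size_block sE.
move=> i; rewrite size_block => il; rewrite nth_mkseq// add0n /word_limit.
have il' : i < wlen (k + i).
  by apply: leq_trans (wlen_gt B32 _); rewrite ltnS leq_addl.
have [id|/ltnW di] := leqP d i; first by rewrite (nth_extend_word _ id).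
by rewrite (nth_extend_word _ di).
Qed.

Lemma word_limit_blocks k u j m : u \in words k ->
  block (word_limit k u) (m * wlen j) (wlen j) \in words j.
Proof.
move=> uW; set D := j + m.+1 * wlen j; set d := k + m.+1 * wlen j.
have E : j + d = k + D by rewrite /d /D; lia.
apply: (@blocks_words_descend _ j d 1) => [m'|].
  rewrite ltnS leqn0 => /eqP->; rewrite mul0n E block_word_limit//.
  exact: extend_word_in.
by rewrite mul1n; apply: ltnW; apply: leq_trans (wlen_gt B32 _); rewrite /d; lia.
Qed.

(** The offset may be the full length of a word, to make room for a star in
    front of a point whose offsets are all 0. *)
Definition structured (x : nat -> A) := forall k, exists2 j, j <= wlen k &
  forall m, block x (j + m * wlen k) (wlen k) \in words k.

Lemma word_limit_structured k u : u \in words k -> structured (word_limit k u).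
Proof. by move=> uW j; exists 0 => // m; exact: word_limit_blocks. Qed.

Lemma structured_shift x : structured x -> structured (shift_seq x).
Proof.
(* A shift moves the offset by one, from 0 to the end of the first word. *)
have shiftE p l : block (shift_seq x) p l = block x p.+1 l by [].
move=> sx k; have [[|j] jk jx] := sx k.
  exists (wlen k).-1; first exact: leq_pred.
  move=> m; rewrite shiftE -addSn prednK ?wlen_gt0//.
  by have := jx m.+1; rewrite add0n mulSn.
by exists j; [exact: ltnW|move=> m; rewrite shiftE -addSn].
Qed.

Lemma structured_not_star x n : structured x -> x n.+1 <> None.
Proof.
move=> /(_ 0)[j j1 jx]; have := jx (n.+1 - j).
rewrite /= muln1 subnKC ?(leq_trans j1)// /block /mkseq/= addn0.
by case/mapP => b _ [->].
Qed.

Lemma word_limit0 k u : u \in words k -> word_limit k u 0 <> None.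
Proof.
move=> uW; have := word_limit_blocks 0 0 uW.
by rewrite mul0n => /mapP[b _ [->]].
Qed.

Definition cons_star (x : nat -> A) : nat -> A :=
  fun n => if n is n'.+1 then x n' else None.

Lemma cons_star_structured k u : u \in words k ->
  structured (cons_star (word_limit k u)).
Proof.
move=> uW j; exists 1; first exact: wlen_gt0.
by move=> m; exact: (word_limit_blocks j m uW).
Qed.

End points.

(** * Occurrences of a local pattern *)

Section occurrences.
Context (A : eqType) (P : pred (seq A)) (r : nat).
Implicit Types (x : nat -> A) (v : seq A) (s : seq (seq A)).

Definition occurrences x p n : nat := \sum_(0 <= i < n) P (block x (p + i) r).

(** Only the windows that lie inside v are counted; the window that ends with
    v is left out as well, which is harmless and gives a simpler range. *)
Definition inner_occurrences v : nat :=
  \sum_(0 <= i < size v - r) P (take r (drop i v)).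

Lemma occurrences_le x p n : occurrences x p n <= n.
Proof.
rewrite -[X in _ <= X]subn0 -[X in _ <= X]muln1 -sum_nat_const_nat.
by apply: leq_sum => i _; exact: leq_b1.
Qed.

Lemma occurrences_add x p m n :
  occurrences x p (m + n) = occurrences x p m + occurrences x (p + m) n.
Proof.
rewrite /occurrences (@big_cat_nat _ _ _ m)//= ?leq_addr//; congr addn.
rewrite -{1}[m]add0n big_addn addKn.
by apply: eq_bigr => i _; rewrite -addnA [m + i]addnC.
Qed.

Lemma occurrences_block x p v : block x p (size v) = v ->
  inner_occurrences v <= occurrences x p (size v) <= inner_occurrences v + r.
Proof.
move=> bv; have E : size v = (size v - r) + (size v - (size v - r)) by lia.
rewrite {1 2}E occurrences_add.
have -> : occurrences x p (size v - r) = inner_occurrences v.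
  rewrite /occurrences /inner_occurrences; apply: eq_big_nat => i /andP[_ ir].
  congr (nat_of_bool (P _)).
  rewrite -{1}bv (_ : size v = i + (r + (size v - r - i))); last lia.
  rewrite !block_add drop_cat size_block ltnn subnn drop0.
  by rewrite take_cat size_block ltnn subnn take0 cats0.
rewrite leq_addr leq_add2l (leq_trans (occurrences_le _ _ _))//; lia.
Qed.

Lemma occurrences_flatten x p s :
  block x p (size (flatten s)) = flatten s ->
  \sum_(v <- s) inner_occurrences v <= occurrences x p (size (flatten s)) <=
  \sum_(v <- s) inner_occurrences v + size s * r.
Proof.
elim: s p => [|v s ih] p; first by rewrite !big_nil /occurrences big_geq.
rewrite !big_cons /= size_cat block_add => /eqP.
rewrite eqseq_cat ?size_block// => /andP[/eqP bv /eqP bs].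
have /andP[v1 v2] := occurrences_block bv.
have /andP[s1 s2] := ih _ bs.
rewrite occurrences_add mulSn; apply/andP; split; lia.
Qed.

Lemma occurrences_blocks x p L q lo hi :
  (forall m, m < q -> lo <= occurrences x (p + m * L) L <= hi) ->
  q * lo <= occurrences x p (q * L) <= q * hi.
Proof.
elim: q => [|q ih] H; first by rewrite !mul0n /occurrences big_geq.
have /andP[h1 h2] := H q (ltnSn q).
have /andP[i1 i2] : q * lo <= occurrences x p (q * L) <= q * hi.
  by apply: ih => m mq; apply: H; exact: leqW.
rewrite [q.+1 * L]mulSnr occurrences_add !mulSnr.
by rewrite !leq_add.
Qed.

End occurrences.

Section structured_occurrences.
Context (B : finType).
Hypothesis B32 : 32 <= #|B|.
Local Notation A := (option B).
Local Notation words := (words B).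
Local Notation wlen := (wlen B).
Context (P : pred (seq A)) (r : nat).

Let c k := \sum_(v <- words k) inner_occurrences P r v.

(** The two bounds do not depend on the word: it is a concatenation of the
    words of level k in some order, and the sum c ignores the order. *)
Lemma occurrences_word (x : nat -> A) p k :
  block x p (wlen k.+1) \in words k.+1 ->
  c k <= occurrences P r x p (wlen k.+1) <= c k + size (words k) * r.
Proof.
move=> bx; have /mapP[s] := bx; rewrite mem_permutations => sW bs.
have szE : size (flatten s) = wlen k.+1 by rewrite -bs size_block.
rewrite -szE /c -(perm_big _ sW) -(perm_size sW).
by apply: occurrences_flatten; rewrite szE.
Qed.

(** The window of q+1 words contains q complete words after the offset, and
    the rest of it has the length of one word. *)
Lemma structured_occurrences (x : nat -> A) k q : structured x ->
  q * c k <= occurrences P r x 0 (q.+1 * wlen k.+1) <=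
  q * (c k + size (words k) * r) + wlen k.+1.
Proof.
move=> /(_ k.+1)[j jL jx]; set L := wlen k.+1 in jL jx *.
have /andP[m1 m2] : q * c k <= occurrences P r x j (q * L) <=
    q * (c k + size (words k) * r).
  by apply: occurrences_blocks => m _; exact: occurrences_word.
have E : q.+1 * L = j + (q * L + (L - j)) by rewrite mulSn; lia.
rewrite E !occurrences_add add0n.
have h1 := occurrences_le P r x 0 j.
have h2 := occurrences_le P r x (j + q * L) (L - j).
apply/andP; split; lia.
Qed.

End structured_occurrences.

Import Order.TTheory GRing.Theory Num.Theory.
Import numFieldNormedType.Exports.

Local Open Scope classical_set_scope.
Local Open Scope ring_scope.

(** * Invariant measures on zero-dimensional compact spaces *)

(** Countable unions are required, rather than a basis of the topology in the
    usual sense, so that the basis generates the Borel sets. *)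
Definition zero_dimensional_basis (X : topologicalType) (G : set (set X)) :=
  [/\ G `<=` clopen, setI_closed G &
      forall U : set X, open U ->
        exists2 F : nat -> set X, (forall i, G (F i)) & U = \bigcup_i F i].

Section borel_clopen.
Context (R : realType) (X : pmetricType R) (G : set (set X)).
Hypothesis GB : zero_dimensional_basis G.

Lemma open_sub_sigma_basis : @open X `<=` <<s G >>.
Proof.
case: GB => _ _ GU U /GU[F GF ->].
by apply: sigma_algebra_bigcup => i; apply: sub_sigma_algebra.
Qed.

Lemma basis_measurable (A : set (borel X)) : G A -> measurable A.
Proof. by case: GB => GC _ _ /GC[oA _]; apply: sub_sigma_algebra. Qed.

(** A basis is closed under intersections, so that the uniqueness of measures
    on a generated sigma-algebra applies. *)
Lemma borel_probability_unique (mu nu : probability (borel X) R) :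
  (forall A : set (borel X), G A -> mu A = nu A) ->
  forall A : set (borel X), measurable A -> mu A = nu A.
Proof.
move=> munu A mA.
have [GC GI GU] := GB.
have [F GF FT] := GU _ openT.
apply: (@measure_unique _ R (borel X) G F _ GI GF (esym FT) mu nu munu) => //.
- change (<<s @open X >> = <<s G >>); rewrite eqEsubset; split.
    by apply: smallest_sub => //; exact: open_sub_sigma_basis.
  by apply: sub_sigma_algebra2 => B /GC[].
- by move=> k; rewrite ltey_eq fin_num_measure//; apply: basis_measurable.
Qed.

End borel_clopen.

(** A copy of X whose measurable sets are the clopen sets, the algebra of sets
    on which the extension of measures is carried out. *)
Definition clopen_algebra (R : realType) (X : pmetricType R) : Type := X.

Section clopen_algebra.
Context (R : realType) (X : pmetricType R).

HB.instance Definition _ := Pointed.on (clopen_algebra X).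

Let clopen_set0 : clopen (set0 : set X). Proof. exact: clopen0. Qed.
Let clopen_setU : setU_closed (@clopen X).
Proof. by move=> A B; exact: clopenU. Qed.
Let clopen_setC : setC_closed (@clopen X).
Proof. by move=> A; exact: clopenC. Qed.

HB.instance Definition _ := @isAlgebraOfSets.Build default_measure_display
  (clopen_algebra X) (@clopen X) clopen_set0 clopen_setU clopen_setC.

End clopen_algebra.

Section clopen_extension.
Context (R : realType) (X : pmetricType R) (c : set X -> R).
Hypothesis compactX : compact [set: X].
Hypothesis c_ge0 : forall A, 0 <= c A.
Hypothesis cT : c setT = 1.
Hypothesis cU : forall A B, A `&` B = set0 -> c (A `|` B) = c A + c B.

Definition clopen_content (A : set (clopen_algebra X)) : \bar R := (c A)%:E.

Let clopen_content_ge0 A : (0 <= clopen_content A)%E.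
Proof. by rewrite lee_fin. Qed.

Let clopen_content_additive : measure_function.semi_additive clopen_content.
Proof.
apply/additive2P.
  rewrite /clopen_content; congr EFin; apply/eqP.
  have := cU (setI0 set0); rewrite setU0 => /eqP.
  by rewrite addrC -subr_eq subrr eq_sym.
by move=> A B mA mB AB; rewrite /clopen_content cU// EFinD.
Qed.

HB.instance Definition _ := isContent.Build _ (clopen_algebra X) R clopen_content
  clopen_content_ge0 clopen_content_additive.

Let clopen_content_sigma : measurable_subset_sigma_subadditive clopen_content.
Proof.
move=> A F mF mA AF.
have cA : compact (A : set X) by apply: subclosed_compact mA.2 compactX _.
move: cA; rewrite compact_cover => /(_ nat setT F (fun i _ => (mF i).1) AF)[D _ AD].
have finD := finite_fset D.
apply: (le_trans (content_sub_fsum clopen_content finD _ mA AD)) => //.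
rewrite nneseries_esumT; last by move=> n; rewrite lee_fin.
by rewrite esum_ge//; eexists; last exact: lexx.
Qed.

HB.instance Definition _ := Content_SigmaSubAdditive_isMeasure.Build _ R
  (clopen_algebra X) clopen_content clopen_content_sigma.

(** A countable cover of a clopen set by clopen sets has a finite subcover, and
    so finite additivity entails countable subadditivity on the clopen
    sets. *)
Lemma clopen_content_extends : zero_dimensional_basis (@clopen X) ->
  exists mu : probability (borel X) R,
    forall A : set (borel X), clopen (A : set X) -> mu A = (c A)%:E.
Proof.
move=> cB.
(* The extension lives on the sigma-algebra generated by the clopen sets; its
   image under the identity is a measure on the Borel sets. *)
pose I : measurableType _ :=
  g_sigma_algebraType (@measurable _ (clopen_algebra X)).
pose m : {measure set I -> \bar R} := measure_extension clopen_content.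
pose h : I -> borel X := idfun.
have mh : measurable_fun [set: I] h.
  move=> _ A mA; rewrite setTI preimage_id.
  have : <<s @open X >> `<=` <<s @clopen X >>.
    by apply: smallest_sub => //; exact: open_sub_sigma_basis.
  exact.
have mE (A : set X) : clopen A -> pushforward m h A = (c A)%:E.
  by move=> cA; rewrite /pushforward preimage_id /m /= /measure_extension
    (@measurable_mu_extE _ R (clopen_algebra X) clopen_content).
have PT : pushforward m h setT = 1%E.
  by rewrite mE ?cT//; exact: clopenT.
pose HP := @Measure_isProbability.Build _ _ _ (pushforward m h).
pose mu : probability (borel X) R := HB.pack (pushforward m h) (HP mh PT).
by exists (mu mh) => A; exact: mE.
Qed.
End clopen_extension.

Lemma fmap_ultra (S T : Type) (f : S -> T) (F : set_system S) :
  UltraFilter F -> UltraFilter (f @ F).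
Proof.
move=> FU; split=> [|G GP FG]; first exact: fmap_proper_filter.
rewrite eqEsubset; split=> [A GA|]; last exact: FG.
have [//|FA] := in_ultra_setVsetC (f @^-1` A) FU.
have /filter_ex[? []//] : G (A `&` ~` A) by apply: filterI => //; exact: FG.
Qed.

Section visits.
Context (X : Type) (T : X -> X).

Definition visits n (A : set X) (x : X) : nat :=
  \sum_(i < n) (iter i T x \in A).

Lemma visitsT n x : visits n setT x = n.
Proof.
rewrite /visits; under eq_bigr do rewrite in_setT.
by rewrite sum_nat_const card_ord muln1.
Qed.

Lemma visits_le n A x : (visits n A x <= n)%N.
Proof.
by rewrite -{2}(visitsT n x) /visits leq_sum// => i _; rewrite in_setT leq_b1.
Qed.

Lemma visitsU n A B x : A `&` B = set0 ->
  visits n (A `|` B) x = (visits n A x + visits n B x)%N.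
Proof.
move=> AB; rewrite /visits -big_split/=; apply: eq_bigr => i _.
rewrite in_setU; case: (boolP (_ \in A)) => //=; case: (boolP (_ \in B)) => //=.
by rewrite !inE => Bx Ax; have : (A `&` B) (iter i T x) by []; rewrite AB.
Qed.

(** The sums telescope.  The correction is bounded by 1, and so the visit
    frequencies are invariant in the limit. *)
Lemma visits_preimage n A x :
  (visits n (T @^-1` A) x + (x \in A) = visits n A x + (iter n T x \in A))%N.
Proof.
rewrite addnC /visits.
rewrite (eq_bigr (fun i : 'I_n => (iter (lift ord0 i) T x \in A) : nat)).
  by rewrite -(big_ord_recr n (fun i => (iter i T x \in A) : nat)) big_ord_recl.
by move=> i _ /=; congr nat_of_bool.
Qed.

End visits.

(** One good window length n per precision is enough to identify the measure
    of A: the mean of the number of visits in n steps is n times that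
    measure. *)
Definition small_oscillation (R : realType) (X : Type) (T : X -> X)
    (A : set X) : Prop :=
  forall e : R, 0 < e -> exists n lo hi : nat,
    [/\ (0 < n)%N, hi%:R - lo%:R <= e * n%:R &
      forall x, (lo <= visits T n A x <= hi)%N].

Section krylov_bogolyubov.
Context (R : realType) (X : pmetricType R) (T : X -> X).
Hypothesis compactX : compact [set: X].
Hypothesis cT : continuous T.

Let avg n A (x : X) : R := n.+1%:R^-1 * (visits T n.+1 A x)%:R.

Let avg_itv n A x : avg n A x \in `[0, 1].
Proof.
rewrite in_itv/= mulr_ge0 ?invr_ge0//= ler_pdivrMl ?ltr0n// mulr1.
by rewrite ler_nat visits_le.
Qed.

Let U : set_system nat := sval (cid (ultraFilterLemma eventually_filter)).
Let UU : UltraFilter U.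
Proof. by rewrite /U; case: cid => ? []. Qed.
Let UP : ProperFilter U. Proof. exact: ultra_proper. Qed.
Local Existing Instance UP.
Let U_oo : U --> \oo.
Proof. by rewrite /U; case: cid => ? []. Qed.

Let c A : R := lim (avg n A point @[n --> U]).

Let cE A : avg n A point @[n --> U] --> c A.
Proof.
have := @segment_compact R 0 1; rewrite compact_ultra.
have I : UltraFilter (avg n A point @[n --> U]) by exact: fmap_ultra.
move=> /(_ _ I)[|p [_ Ap]].
  by apply: (@filterS _ U _ setT) => [n _/=|]; [exact: avg_itv|exact: filterT].
by apply/cvg_ex; exists p.
Qed.

Let c_lim A (l : R) : avg n A point @[n --> U] --> l -> c A = l.
Proof. by move=> Al; apply/cvg_lim. Qed.

Lemma continuous_borel_measurable :
  measurable_fun [set: borel X] (T : borel X -> borel X).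
Proof.
apply: (@measurability _ _ (borel X) (borel X) setT T (@open X)) => // _ [V oV <-].
by rewrite setTI; apply: sub_sigma_algebra; move/continuousP: cT; exact.
Qed.

(** Krylov and Bogolyubov.  A limit along an ultrafilter exists for all sets at
    once, and needs no convergence of the visit frequencies. *)
Lemma exists_invariant_probability : zero_dimensional_basis (@clopen X) ->
  exists mu : probability (borel X) R, invariant_measure T mu.
Proof.
move=> cB.
have c_ge0 A : 0 <= c A.
  apply: limr_ge; first by apply/cvg_ex; exists (c A); exact: cE.
  by apply: nearW => n; have := avg_itv n A point; rewrite in_itv/= => /andP[].
have cT1 : c setT = 1.
  apply: c_lim; rewrite (_ : (fun n => _) = cst 1); first exact: cvg_cst.
  by apply/funext => n; rewrite /avg visitsT mulVf.
have cU A B : A `&` B = set0 -> c (A `|` B) = c A + c B.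
  move=> AB; apply: c_lim.
  rewrite (_ : (fun n => _) = (fun n => avg n A point + avg n B point)).
    by apply: cvgD; exact: cE.
  by apply/funext => n; rewrite /avg visitsU// natrD mulrDr.
have c_inv A : c (T @^-1` A) = c A.
  apply: c_lim.
  pose b n : R := (iter n.+1 T point \in A)%:R - (point \in A)%:R.
  rewrite (_ : (fun n => _) = (fun n => avg n A point + n.+1%:R^-1 * b n)).
    rewrite -[X in _ --> X]addr0; apply: cvgD; first exact: cE.
    apply: cvg_trans; first exact: (@cvg_app _ _ _ _ (fun n => n.+1%:R^-1 * b n) U_oo).
    apply/cvgr0Pnorm_le => e e0.
    have /cvgr0Pnorm_le /(_ _ e0) he := @cvg_harmonic R.
    apply: filterS he => n; rewrite /harmonic /= => he.
    rewrite normrM (le_trans _ he)// ler_piMr//.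
    by rewrite /b; do 2!case: (_ \in _);
      rewrite ?subrr ?subr0 ?sub0r ?normrN ?normr0 ?normr1.
  apply/funext => n; rewrite /avg -mulrDr; congr (_ * _).
  rewrite /b addrA -natrD -visits_preimage natrD -addrA subrr addr0//.
have [mu muE] := clopen_content_extends compactX c_ge0 cT1 cU cB.
have mT := continuous_borel_measurable.
pose Tm : {mfun borel X >-> borel X} := HB.pack (T : borel X -> borel X)
  (isMeasurableFun.Build _ _ _ _ _ mT).
exists mu => A mA; rewrite -[LHS]/(distribution mu Tm A).
apply: (borel_probability_unique cB) => // C cC.
rewrite (muE C cC) -[LHS]/(mu (T @^-1` C)) muE ?c_inv//.
exact: (@preimage_clopen X X T C cC cT).
Qed.

(** The function [visits T n A] has integral n times the measure of A for
    every invariant measure, so that its minimum and its maximum bound the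
    measure of A. *)
Lemma small_oscillation_unique (G : set (set X)) :
  zero_dimensional_basis G ->
  (forall A, G A -> small_oscillation R T A) ->
  forall mu nu : probability (borel X) R,
    invariant_measure T mu -> invariant_measure T nu ->
    forall A : set (borel X), measurable A -> nu A = mu A.
Proof.
move=> GB osc.
have iterm i (A : set (borel X)) : measurable A ->
    measurable (iter i T @^-1` A : set (borel X)).
  move=> mA; elim: i => [//|i ih].
  have -> : iter i.+1 T @^-1` A = T @^-1` (iter i T @^-1` A).
    by apply/funext => x; rewrite /preimage/= -iterSr.
  by rewrite -[X in measurable X]setTI; exact: continuous_borel_measurable.
have iterE (mu : probability (borel X) R) i (A : set (borel X)) :
    invariant_measure T mu -> measurable A -> mu (iter i T @^-1` A) = mu A.
  move=> imu mA; elim: i => [//|i ih].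
  have -> : iter i.+1 T @^-1` A = T @^-1` (iter i T @^-1` A).
    by apply/funext => x; rewrite /preimage/= -iterSr.
  by rewrite imu//; exact: iterm.
have muN (mu : probability (borel X) R) n lo hi (A : set (borel X)) :
    invariant_measure T mu -> measurable A ->
    (forall x, (lo <= visits T n A x <= hi)%N) ->
  lo%:R <= n%:R * fine (mu A) <= hi%:R.
  move=> imu mA vis.
  have visE x : ((visits T n A x)%:R : R)%:E =
      (\sum_(i < n) (\1_(iter i T @^-1` A) x)%:E)%E.
    by rewrite sumEFin /visits natr_sum; congr EFin; apply: eq_bigr => i _;
      rewrite indicE; congr (_%:R); congr nat_of_bool; apply/idP/idP; rewrite !inE.
  have mind i : measurable_fun [set: borel X]
      (fun x => (\1_(iter i T @^-1` A) x : R)%:E).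
    by apply/measurable_EFinP; apply: measurable_indic; exact: iterm.
  have mvis : measurable_fun [set: borel X]
      (fun x : borel X => ((visits T n A x)%:R : R)%:E).
    under eq_fun do rewrite visE.
    exact: emeasurable_sum.
  have intE : (\int[mu]_x ((visits T n A x)%:R : R)%:E = (n%:R * fine (mu A))%:E)%E.
    under eq_integral do rewrite visE.
    rewrite ge0_integral_sum//.
    have -> : (\sum_(i < n) \int[mu]_x (\1_(iter i T @^-1` A) x : R)%:E =
               \sum_(i < n) mu A)%E.
      apply: eq_bigr => i _; rewrite integral_indic//.
        by rewrite setIT; exact: (iterE mu i A imu mA).
      exact: (iterm i A mA).
    rewrite -[in LHS](@fineK _ (mu A)) ?fin_num_measure// sumEFin.
    by rewrite sumr_const card_ord mulr_natl.
  have cstE (r : nat) : (\int[mu]_x (cst (r%:R : R)%:E x) = r%:R%:E)%E.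
    have muT : mu [set: borel X] = 1%E by exact: probability_setT.
    by rewrite integral_cst// [X in (_ * X)%E]muT mule1.
  apply/andP; split; rewrite -lee_fin -intE -cstE; apply: ge0_le_integral => //.
  - by move=> x _; rewrite lee_fin.
  - by move=> x _; rewrite lee_fin ler_nat; case/andP: (vis x).
  - by move=> x _; rewrite lee_fin ler_nat; case/andP: (vis x).
move=> mu nu imu inu; apply: (borel_probability_unique GB) => A GA.
have mA := basis_measurable GB GA.
have fin (m : probability (borel X) R) : m A \is a fin_num by exact: fin_num_measure.
rewrite -(fineK (fin mu)) -(fineK (fin nu)); congr EFin.
apply/eqP; rewrite -subr_eq0 -normr_le0; apply/ler_addgt0Pl => e e0; rewrite addr0.
have [n [lo [hi [n0 hl vis]]]] := osc A GA e e0.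
have /andP[m1 m2] := muN mu n lo hi A imu mA vis.
have /andP[v1 v2] := muN nu n lo hi A inu mA vis.
rewrite -(@ler_pM2l _ n%:R) ?ltr0n// [X in _ <= X]mulrC (le_trans _ hl)//.
rewrite -{1}(ger0_norm (ler0n R n)) -normrM mulrBr ler_norml.
by apply/andP; split; [rewrite lerNl opprB|]; rewrite lerB.
Qed.

End krylov_bogolyubov.

Lemma uniquely_ergodic_small_oscillation (R : realType) (X : pmetricType R)
    (T : X -> X) (G : set (set X)) :
  tds T -> zero_dimensional_basis G ->
  (forall A, G A -> small_oscillation R T A) ->
  uniquely_ergodic T.
Proof.
move=> [cX cT] GB osc.
have cB : zero_dimensional_basis (@clopen X).
  have [GC _ GU] := GB.
  split=> // [A B|U /GU[F GF ->]]; first exact: clopenI.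
  by exists F => // i; exact: GC.
have [mu imu] := exists_invariant_probability cX cT cB.
by exists mu => // nu inu; exact: (small_oscillation_unique cT GB osc).
Qed.

(** * Spaces of sequences *)

Section agree.
Context (A : Type).
Implicit Types (x y z : nat -> A).

Definition agree n x y := forall i, (i < n)%N -> x i = y i.

Lemma agree_sym n x y : agree n x y -> agree n y x.
Proof. by move=> xy i ni; rewrite xy. Qed.

Lemma agree_trans n y x z : agree n x y -> agree n y z -> agree n x z.
Proof. by move=> xy yz i ni; rewrite xy// yz. Qed.

Lemma agreeW m n x y : (m <= n)%N -> agree n x y -> agree m x y.
Proof. by move=> mn xy i im; apply: xy; exact: leq_trans mn. Qed.

End agree.

(** The field R is an argument because the distance takes its values in it;
    the base point x0 makes the space a pointed type. *)
Definition seq_space (R : realType) (A : Type) (Z : set (nat -> A))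
  (x0 : nat -> A) (Zx0 : Z x0) : Type := {x : nat -> A | Z x}.

Section seq_space_metric.
Context (R : realType) (A : Type) (Z : set (nat -> A)) (x0 : nat -> A).
Context (Zx0 : Z x0).
Local Notation X := (seq_space R Zx0).

HB.instance Definition _ := gen_eqMixin X.
HB.instance Definition _ := gen_choiceMixin X.
HB.instance Definition _ := isPointed.Build X (exist _ x0 Zx0).

Implicit Types (x y z : X).

Lemma seq_space_inj x y : sval x =1 sval y -> x = y.
Proof.
case: x y => [x Zx] [y Zy]/= /funext xy.
by subst y; congr exist; exact: Prop_irrelevance.
Qed.

Let D x y : set R :=
  [set n.+1%:R^-1 | n in [set n | agree n (sval x) (sval y)]].

(* The distance is 1/(n+1) when x and y first differ in the coordinate n. *)
Let dist x y : R := inf (D x y).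

Let hD x y : has_inf (D x y).
Proof.
split; first by exists 1%:R^-1; exists 0%N.
by exists 0 => _ [n _ <-]; rewrite invr_ge0.
Qed.

Let dist_le n x y : agree n (sval x) (sval y) -> dist x y <= n.+1%:R^-1.
Proof. by move=> xy; apply: inf_lbound; [have [] := hD x y|exists n]. Qed.

Let dist_lt n x y : dist x y < n.+1%:R^-1 -> agree n.+1 (sval x) (sval y).
Proof.
move=> /(inf_lt (proj1 (hD x y)))[_ [m xy <-]].
by rewrite ltf_pV2 ?posrE// ltr_nat ltnS => nm; exact: agreeW xy.
Qed.

Let distxx x : dist x x = 0.
Proof.
apply/eqP; rewrite eq_le; apply/andP; split; last first.
  by apply: lb_le_inf; [have [] := hD x x|move=> _ [n _ <-]; rewrite invr_ge0].
rewrite leNgt; apply/negP => d0.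
have [n] := @ltr_add_invr R 0 (dist x x) d0.
by rewrite add0r ltNge dist_le.
Qed.

Let dist_pos x y : dist x y = 0 -> x = y.
Proof.
move=> xy; apply: seq_space_inj => i.
by apply: (@dist_lt i x y) => //; rewrite xy invr_gt0.
Qed.

Let dist_sym x y : dist x y = dist y x.
Proof.
congr inf; apply/seteqP; split=> _ [n xy <-]; exists n => //; exact: agree_sym.
Qed.

Let dist_triangle y x z : dist x z <= dist x y + dist y z.
Proof.
rewrite -lerBlDr; apply: lb_le_inf; first by have [] := hD x y.
move=> _ [n xy <-]; rewrite lerBlDr -lerBlDl.
apply: lb_le_inf; first by have [] := hD y z.
move=> _ [m yz <-]; rewrite lerBlDl.
have [nm|mn] := leqP n m.
  rewrite (@le_trans _ _ n.+1%:R^-1) ?lerDl ?invr_ge0//.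
  by apply: dist_le; apply: agree_trans xy _; exact: agreeW yz.
rewrite (@le_trans _ _ m.+1%:R^-1) ?lerDr ?invr_ge0//.
by apply: dist_le; apply: agree_trans yz; apply: agreeW xy; exact: ltnW.
Qed.

HB.instance Definition _ :=
  isMetric.Build R X distxx dist_pos dist_sym dist_triangle.

Lemma seq_space_nbhsP x (U : set X) :
  nbhs x U <-> exists n, forall y, agree n (sval x) (sval y) -> U y.
Proof.
split=> [/nbhs_ballP[e /= e0 eU]|[n nU]].
  have [n] := @ltr_add_invr R 0 e e0; rewrite add0r => ne.
  exists n => y xy; apply: eU; rewrite ballEmdist/=.
  by apply: le_lt_trans ne; exact: dist_le.
apply/nbhs_ballP; exists n.+1%:R^-1 => /=; first by rewrite invr_gt0.
by move=> y; rewrite ballEmdist/= => /dist_lt xy; apply: nU; exact: agreeW xy.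
Qed.

End seq_space_metric.

Section seq_space_topology.
Context (R : realType) (A : Type) (Z : set (nat -> A)) (x0 : nat -> A).
Context (Zx0 : Z x0).
Local Notation X := (seq_space R Zx0).
Implicit Types (x y z : X).

Definition finitary : set (set X) :=
  [set C | exists r, forall x y, agree r (sval x) (sval y) -> C x -> C y].

Lemma finitary_open (C : set X) : finitary C -> open C.
Proof.
move=> [r rC]; rewrite openE => x Cx; apply/seq_space_nbhsP.
by exists r => y xy; exact: rC Cx.
Qed.

(** An open set U is the union over n of the sets of the points x such that
    every point that agrees with x on n coordinates is in U. *)
Lemma finitary_zero_dimensional : zero_dimensional_basis finitary.
Proof.
split.
- move=> C fC; split; first exact: finitary_open.
  rewrite -openC; apply: finitary_open; have [r rC] := fC.
  exists r => x y xy nCx Cy; apply: nCx.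
  by apply: rC Cy; exact: agree_sym.
- move=> B C [r rB] [s sC]; exists (maxn r s) => x y xy [Bx Cx]; split.
    by apply: rB Bx; apply: agreeW xy; exact: leq_maxl.
  by apply: sC Cx; apply: agreeW xy; exact: leq_maxr.
- move=> U oU.
  exists (fun n => [set x | forall y, agree n (sval x) (sval y) -> U y]).
    move=> n; exists n => x y xy xU z yz; apply: xU; exact: agree_trans yz.
  apply/seteqP; split=> [x Ux|x [n _]]; last exact.
  have /seq_space_nbhsP[n nU] : nbhs x U by exact: open_nbhs_nbhs.
  by exists n.
Qed.

Context (shiftZ : forall a, Z a -> Z (shift_seq a)).

Definition shift_map x : X := exist _ _ (shiftZ (svalP x)).

Lemma iter_shift_mapE n x i : sval (iter n shift_map x) i = sval x (n + i)%N.
Proof. by elim: n i => [//|n ih] i; rewrite /= /shift_seq ih addnS. Qed.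

Lemma shift_map_continuous : continuous shift_map.
Proof.
move=> x U /= /seq_space_nbhsP[n nU]; apply/seq_space_nbhsP.
by exists n.+1 => y xy; apply: nU => i ni; exact: xy.
Qed.

End seq_space_topology.

(** An ultrafilter selects one letter in each coordinate, since there are
    finitely many, and it converges to the sequence of these letters. *)
Lemma seq_space_compact (R : realType) (A : finType) (Z : set (nat -> A))
    (x0 : nat -> A) (Zx0 : Z x0) :
  (forall a, (forall n, exists2 x, Z x & agree n a x) -> Z a) ->
  compact [set: seq_space R Zx0].
Proof.
move=> Zclosed; rewrite compact_ultra => F UF _.
have PF : ProperFilter F by exact: ultra_proper.
have /choice[a Fa] n : exists a, F [set x | sval x n = a].
  apply: contrapT => /forallNP nF.
  have : F (fun x => forall a, sval x n <> a).
    apply: filter_forall => a.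
    by have [/nF//|] := in_ultra_setVsetC [set x | sval x n = a] UF.
  by move=> /filter_ex[x /(_ (sval x n))].
have Fagree n : F (fun x => agree n a (sval x)).
  have : F (fun x => forall i : 'I_n, sval x i = a i).
    by apply: filter_forall => i; exact: Fa.
  by apply: filterS => x xa i ni; rewrite (xa (Ordinal ni)).
have Za : Z a.
  apply: Zclosed => n; have [x ax] := filter_ex (Fagree n).
  by exists (sval x) => //; exact: svalP.
exists (exist _ a Za); split=> // U /seq_space_nbhsP[n nU].
by apply: filterS (Fagree n) => x; exact: nU.
Qed.

(** * Entropy of a shift *)

Lemma subadditive_mul (R : realType) (a : nat -> R) :
  (forall m n, a (m + n)%N <= a m + a n) ->
  forall q s n, a (q * n + s)%N <= q%:R * a n + a s.
Proof.
move=> asub; elim=> [|q ih] s n; first by rewrite mul0r add0r.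
rewrite mulSn -addnA (le_trans (asub _ _))// -natr1 mulrDl mul1r.
by have := ih s n; lra.
Qed.

(** Fekete's lemma: the limit is the infimum of the a n / n.  If n0 comes within
    e/2 of it, division by n0 with remainder bounds a n by
    (n / n0) a n0 plus a constant M. *)
Lemma fekete (R : realType) (a : nat -> R) :
  (forall n, 0 <= a n) -> (forall m n, a (m + n)%N <= a m + a n) ->
  cvgn (fun n => n%:R^-1 * a n).
Proof.
move=> a0 asub; pose E : set R := [set n%:R^-1 * a n | n in [set n | (0 < n)%N]].
have lbE : lbound E 0 by move=> _ [n _ <-]; rewrite mulr_ge0// invr_ge0.
have iE : has_inf E by split; [exists (1%:R^-1 * a 1%N), 1%N|exists 0].
apply/cvg_ex; exists (inf E); apply/cvgrPdist_le => e e0.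
have e20 : 0 < e / 2 by rewrite divr_gt0.
have [_ [n0 /= n00 <-] an0] := inf_lt iE.1 (ltr_pwDr e20 (lexx (inf E))).
pose M := \sum_(s < n0) a s.
have aM s : (s < n0)%N -> a s <= M.
  move=> sn0; rewrite /M (bigD1 (Ordinal sn0))//= lerDl; exact: sumr_ge0.
have M0 : 0 <= M by exact: sumr_ge0.
have /cvgr0Pnorm_le /(_ _ e20) : (fun n => M * n.+1%:R^-1) @ \oo --> (0 : R).
  by rewrite -[X in _ --> X](mulr0 M); apply: cvgMr; exact: cvg_harmonic.
move=> [N _ NM]; exists N.+1 => // n /= Nn.
case: n Nn => // n Nn.
have ninf : inf E <= n.+1%:R^-1 * a n.+1.
  by apply: ge_inf; [exact: iE.2|exists n.+1].
rewrite distrC ger0_norm ?subr_ge0// lerBlDl.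
have -> : inf E + e = (inf E + e / 2) + e / 2 by rewrite -addrA -splitr.
have := NM n Nn; rewrite ger0_norm ?mulr_ge0// => Mn.
rewrite (@le_trans _ _ (n0%:R^-1 * a n0 + M * n.+1%:R^-1))//; last first.
  by apply: lerD => //; exact: ltW.
rewrite ler_pdivrMl ?ltr0n// mulrDr [_ * (M * _)]mulrCA divff// mulr1.
rewrite [X in a X](divn_eq n.+1 n0) (le_trans (subadditive_mul asub _ _ _))//.
apply: lerD; last by apply: aM; rewrite ltn_mod.
rewrite mulrA ler_wpM2r// ler_pdivlMr ?ltr0n// -natrM ler_nat.
exact: leq_trunc_div.
Qed.

Lemma limn_ge_frequently (R : realType) (u : nat -> R) (l : R) :
  cvgn u -> (forall N, exists2 n, (N <= n)%N & l <= u n) -> l <= limn u.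
Proof.
move=> cu lu; rewrite leNgt; apply/negP => ul.
have [N _ Nu] : \forall n \near \oo, u n < l by exact: cvgr_lt ul.
by have [n /Nu/= un] := lu N; rewrite leNgt un.
Qed.

Section cover_number_fibres.
Context (R : realType) (X : Type) (F : finType) (f : X -> F).

(** The non-empty fibres form a partition, hence a subcover that is contained in
    all the others. *)
Lemma cover_number_fibres :
  cover_number R [set f @^-1` [set t] | t in [set: F]] =
  #|[set t | `[< exists x, f x = t >]]%SET|%:R.
Proof.
set S := [set t | _]%SET.
pose W : set (set X) := [set f @^-1` [set t] | t in [set` S]].
have WS : (W #= `I_#|S|)%card.
  apply: (@card_eq_trans _ _ _ _ [set` S]).
    apply: inj_card_eq => s t; move=> /set_mem/= + /set_mem/= _.
    rewrite inE => /asboolP[x xs] fst.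
    have : (f @^-1` [set s]) x by [].
    by rewrite fst /= xs.
  have <- : [set index t (enum S) | t in [set` S]] = `I_#|S|.
    apply/seteqP; split=> [_ [t /= tS <-]|n /= nS].
      by rewrite cardE index_mem mem_enum.
    have [t0 _] : exists t, t \in S.
      by apply/set0Pn; rewrite -card_gt0 (leq_ltn_trans _ nS).
    have nE : (n < size (enum S))%N by rewrite -cardE.
    exists (nth t0 (enum S) n); last by rewrite index_uniq ?enum_uniq.
    by rewrite /= -mem_enum mem_nth.
  rewrite card_eq_sym; apply: inj_card_eq => s t /set_mem/= sS /set_mem/= tS st.
  by rewrite -(@nth_index _ s s (enum S)) ?mem_enum// st nth_index// mem_enum.
have Wc : is_cover W.
  apply/seteqP; split=> // x _; exists (f @^-1` [set f x]) => //.
  by exists (f x) => //; rewrite /= inE; apply/asboolP; exists x.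
have Wmin V : V `<=` [set f @^-1` [set t] | t in [set: F]] -> is_cover V ->
    W `<=` V.
  move=> VF Vc _ [t /= + <-]; rewrite inE => /asboolP[x fx].
  have [B VB Bx] : (\bigcup_(A in V) A) x by rewrite Vc.
  have [s _ Bs] := VF _ VB.
  by move: Bx VB; rewrite -Bs /= fx => ->.
rewrite /cover_number; set N := [set _ | _ in _].
have NS : N #|S|%:R.
  exists #|S| => //; exists W; split=> // _ [t _ <-]; by exists t.
have lbN : lbound N #|S|%:R.
  move=> _ [m [V [VF Vm Vc]] <-]; rewrite ler_nat.
  have /subset_card_le := Wmin V VF Vc.
  by rewrite (card_le_eql WS) (card_le_eqr Vm) card_le_II.
apply/eqP; rewrite eq_le; apply/andP; split.
  by apply: ge_inf => //; exists #|S|%:R.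
by apply: lb_le_inf => //; exists #|S|%:R.
Qed.
End cover_number_fibres.

Section shift_entropy.
Context (R : realType) (A : finType) (Z : set (nat -> A)) (x0 : nat -> A).
Context (Zx0 : Z x0) (shiftZ : forall a, Z a -> Z (shift_seq a)).
Local Notation X := (seq_space R Zx0).
Local Notation T := (@shift_map R A Z x0 Zx0 shiftZ).

Definition prefix_word n (a : nat -> A) : {ffun 'I_n -> A} :=
  [ffun i : 'I_n => a i].

Definition language n : {set {ffun 'I_n -> A}} :=
  [set t | `[< exists x : X, prefix_word n (sval x) = t >]]%SET.

Definition zero_coordinate_cover : set (set X) :=
  [set [set x : X | sval x 0%N = a] | a in [set: A]].

Lemma zero_coordinate_open_cover : open_cover zero_coordinate_cover.
Proof.
split=> [_ [a _ <-]|].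
  apply: finitary_open; exists 1%N => x y xy /= <-.
  by rewrite (xy 0%N).
apply/seteqP; split=> // x _.
by exists [set y : X | sval y 0%N = sval x 0%N] => //; exists (sval x 0%N).
Qed.

Lemma iterated_join_zero_coordinate n :
  iterated_join T zero_coordinate_cover n =
  [set (fun x : X => prefix_word n (sval x)) @^-1` [set t] |
    t in [set: {ffun 'I_n -> A}]].
Proof.
apply/seteqP; split=> [_ [V VU <-]|_ [t _ <-]].
  have /choice[a aV] i : exists a, [set x : X | sval x 0%N = a] = V i.
    by have [a _ aV] := VU i; exists a.
  exists (prefix_word n a) => //; apply/seteqP; split=> x /=.
    move=> /ffunP xa i /= ni; have := xa (Ordinal ni).
    by rewrite -aV /= iter_shift_mapE addn0 !ffunE.
  move=> xV; apply/ffunP => i; rewrite !ffunE.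
  by have := xV i (ltn_ord i); rewrite /= -aV /= iter_shift_mapE addn0.
(* A letter is needed beyond the length n of t as well; any one will do. *)
pose V i :=
  [set x : X | sval x 0%N = if insub i is Some j then t j else x0 0%N].
exists V; first by move=> i; eexists.
apply/seteqP; split=> x /=.
  move=> xV; apply/ffunP => i; rewrite !ffunE.
  by have := xV i (ltn_ord i); rewrite /V /= iter_shift_mapE addn0 valK.
move=> xt i /= ni; rewrite /V /= iter_shift_mapE addn0 insubT -xt ffunE.
by [].
Qed.

Lemma cover_number_zero_coordinate n :
  cover_number R (iterated_join T zero_coordinate_cover n) = #|language n|%:R.
Proof. by rewrite iterated_join_zero_coordinate cover_number_fibres. Qed.

Lemma language_gt0 n : (0 < #|language n|)%N.
Proof.
rewrite card_gt0; apply/set0Pn; exists (prefix_word n x0).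
by rewrite inE; apply/asboolP; exists (exist _ x0 Zx0).
Qed.

Lemma language_submul m n :
  (#|language (m + n)| <= #|language m| * #|language n|)%N.
Proof.
rewrite -cardsX.
pose f (t : {ffun 'I_(m + n) -> A}) : {ffun 'I_m -> A} * {ffun 'I_n -> A} :=
  ([ffun i => t (lshift n i)], [ffun i => t (rshift m i)]).
have f_inj : injective f.
  move=> s t [/ffunP st1 /ffunP st2]; apply/ffunP => i.
  case: (split_ordP i) => j ->.
    by have := st1 j; rewrite !ffunE.
  by have := st2 j; rewrite !ffunE.
rewrite -(card_imset _ f_inj) subset_leq_card//.
apply/fintype.subsetP => _ /imsetP[t tL ->].
move: tL; rewrite inE => /asboolP[x <-]; rewrite !inE /=.
apply/andP; split; apply/asboolP.
  by exists x; apply/ffunP => i; rewrite !ffunE.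
by exists (iter m T x); apply/ffunP => i; rewrite !ffunE iter_shift_mapE.
Qed.

(** The existence of the limit follows from the submultiplicativity of the
    number of prefixes, so that it can be bounded along a subsequence. *)
Lemma shift_entropy_gt0 :
  (forall N, exists2 n, (N < n)%N & (2 ^ n <= #|language n|)%N) ->
  (0 < topological_entropy T)%E.
Proof.
move=> big.
have ln2 : 0 < ln (2 : R) by rewrite ln_gt0// ltr1n.
suff H : ln (2 : R) <= cover_entropy R T zero_coordinate_cover.
  apply: (@lt_le_trans _ _ (cover_entropy R T zero_coordinate_cover)%:E).
    by rewrite lte_fin (lt_le_trans ln2).
  apply: ereal_sup_ubound; exists zero_coordinate_cover => //.
  exact: zero_coordinate_open_cover.
rewrite /cover_entropy; apply: limn_ge_frequently.
  apply: fekete => [n|m n]; rewrite !cover_number_zero_coordinate.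
    by rewrite ln_ge0// ler1n language_gt0.
  rewrite -lnM ?posrE ?ltr0n ?language_gt0//.
  rewrite ler_ln ?posrE -?natrM ?ltr0n ?muln_gt0 ?language_gt0//.
  by rewrite ler_nat language_submul.
move=> N; have [n Nn n2] := big N; exists n; first exact: ltnW.
rewrite cover_number_zero_coordinate ler_pdivlMl ?ltr0n; last exact: leq_ltn_trans Nn.
rewrite mulr_natl -lnXn// ler_ln ?posrE ?exprn_gt0// ?ltr0n ?language_gt0//.
by rewrite -natrX ler_nat.
Qed.

End shift_entropy.

(** * The system *)

Section grillenberger.
Context (R : realType) (B : finType).
Hypothesis B32 : (32 <= #|B|)%N.
Context (b0 : B).
Local Notation A := (option B).
Local Notation words := (words B).
Local Notation wlen := (wlen B).

Let y0 := word_limit 0 [:: Some b0].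
Let b0W : [:: Some b0] \in words 0.
Proof. by apply: map_f; rewrite mem_enum. Qed.

(** The only point that begins with a star is the star followed by y0. *)
Definition grillenberger : set (nat -> A) :=
  [set x | structured x /\ (x 0%N = None -> x = cons_star y0)].

Lemma grillenberger_word_limit k u :
  u \in words k -> grillenberger (word_limit k u).
Proof.
by move=> uW; split; [exact: word_limit_structured|move=> /(word_limit0 B32 uW)].
Qed.

Lemma grillenberger_star : grillenberger (cons_star y0).
Proof. by split=> //; exact: (cons_star_structured B32 b0W). Qed.

Lemma grillenberger_shift x : grillenberger x -> grillenberger (shift_seq x).
Proof.
move=> [sx _]; split; first exact: structured_shift.
by move=> /(structured_not_star sx).
Qed.

(** If all of the finitely many offsets fail for a at some level, then they all
    fail within a finite window of a. *)
Lemma grillenberger_closed a :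
  (forall n, exists2 x, grillenberger x & agree n a x) -> grillenberger a.
Proof.
move=> ax; split=> [k|a0].
  apply: contrapT => nj.
  have /choice[m mP] j : exists m, (j <= wlen k)%N ->
      block a (j + m * wlen k) (wlen k) \notin words k.
    apply: contrapT => /forallNP nm; apply: nj; exists j.
      by apply: contrapT => jk; apply: (nm 0%N).
    move=> m; apply: contrapT => /negP bm; exact: (nm m).
  pose n := (\max_(j < (wlen k).+1) (j + m j * wlen k + wlen k))%N.
  have [x [sx _] xa] := ax n.
  have [j jk jx] := sx k.
  have jn : (j + m j * wlen k + wlen k <= n)%N.
    exact: (leq_bigmax (Ordinal (jk : (j < (wlen k).+1)%N))).
  have /negP := mP j jk; apply.
  rewrite (@block_eq _ _ x) => [|i ij]; first exact: jx.
  by apply: xa; exact: leq_trans jn.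
apply/funext => i; have [x [_ xs] xa] := ax i.+1.
by rewrite xa// xs// -xa.
Qed.

Local Notation X := (seq_space R grillenberger_star).
Local Notation T := (@shift_map R _ _ _ grillenberger_star grillenberger_shift).

Lemma grillenberger_tds : tds T.
Proof.
split; last exact: shift_map_continuous.
exact: seq_space_compact grillenberger_closed.
Qed.

Lemma visits_occurrences (C : set X) r :
  (forall x y : X, agree r (sval x) (sval y) -> C x -> C y) ->
  exists P, forall n x, visits T n C x = occurrences P r (sval x) 0 n.
Proof.
move=> rC.
pose P w := `[< exists2 y : X, C y & block (sval y) 0 r = w >].
have CP (x : X) : (x \in C) = P (block (sval x) 0 r).
  apply/idP/asboolP; rewrite inE; first by exists x.
  move=> [y Cy] yx; apply: rC Cy => i ir.
  have := congr1 (fun s => nth None s i) yx.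
  by rewrite !nth_mkseq.
exists P => n x; rewrite /visits /occurrences big_mkord; apply: eq_bigr => i _.
rewrite CP; congr (nat_of_bool (P _)); apply: eq_map => j.
by rewrite iter_shift_mapE.
Qed.

Lemma grillenberger_small_oscillation (C : set X) : finitary C ->
  small_oscillation R T C.
Proof.
move=> [r rC] e e0; have [P PE] := visits_occurrences rC.
(* With n = (q+1) N l, where N and l are the number and the length of the words
   of level k, the oscillation is at most q N r + N l.  The first choice bounds
   q N r by e q N l / 2, and the second one bounds N l by the same quantity. *)
have [k kP] : exists k, 2 * r%:R <= e * (wlen k)%:R.
  exists (Num.bound (2 * r%:R / e)); rewrite [e * _]mulrC -ler_pdivrMr//.
  apply: le_trans (ltW (archi_boundP _)) _; last by rewrite ler_nat ltnW// wlen_gt.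
  by rewrite divr_ge0 ?mulr_ge0// ltW.
have [q qP] : exists q, 2 <= e * q%:R.
  exists (Num.bound (2 / e)); rewrite [e * _]mulrC -ler_pdivrMr//.
  by apply/ltW/archi_boundP; rewrite divr_ge0// ltW.
pose c := (\sum_(v <- words k) inner_occurrences P r v)%N.
exists (q.+1 * wlen k.+1)%N, (q * c)%N.
exists (q * (c + size (words k) * r) + wlen k.+1)%N.
split.
- by rewrite muln_gt0/= (wlen_gt0 B32 k.+1).
- rewrite -[wlen k.+1]/(size (words k) * wlen k)%N mulnDr !natrD !natrM.
  have q0 : 0 <= q%:R :> R by [].
  have l0 : 0 <= (wlen k)%:R :> R by [].
  have -> (a b n l rr : R) :
      a + b * (n * rr) + n * l - a = n * (b * rr + l) by ring.
  rewrite (_ : e * _ = (size (words k))%:R * (e * (q%:R + 1) * (wlen k)%:R));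
    last by ring.
  apply: ler_wpM2l => //.
  have h1 : q%:R * (2 * r%:R) <= q%:R * (e * (wlen k)%:R) by exact: ler_wpM2l.
  have h2 : 2 * (wlen k)%:R <= e * q%:R * (wlen k)%:R by exact: ler_wpM2r.
  have h3 : 0 <= e * (wlen k)%:R by rewrite mulr_ge0// ltW.
  lra.
- by move=> x; rewrite PE; apply: structured_occurrences => //; exact: (svalP x).1.
Qed.

Lemma grillenberger_uniquely_ergodic : uniquely_ergodic T.
Proof.
apply: uniquely_ergodic_small_oscillation grillenberger_tds _ _.
  exact: finitary_zero_dimensional.
exact: grillenberger_small_oscillation.
Qed.

Lemma language_words k :
  (size (words k) <= #|language R grillenberger_star (wlen k)|)%N.
Proof.
pose g (u : seq A) : {ffun 'I_(wlen k) -> A} :=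
  [ffun i => nth None u (nat_of_ord i)].
rewrite -(size_map g) cardE; apply: uniq_leq_size.
  rewrite map_inj_in_uniq ?words_uniq// => u v uW vW uv.
  apply: (@eq_from_nth _ None); first by rewrite !(@size_word _ k).
  move=> i; rewrite (size_word uW) => ik.
  by have /ffunP/(_ (Ordinal ik)) := uv; rewrite !ffunE.
move=> _ /mapP[u uW ->]; rewrite mem_enum inE; apply/asboolP.
exists (exist _ _ (grillenberger_word_limit uW)).
apply/ffunP => i; rewrite !ffunE/=.
have := @block_word_limit _ B32 k u 0 uW; rewrite addn0 /= => bE.
by rewrite -[in RHS]bE nth_mkseq.
Qed.

Lemma grillenberger_entropy : (0 < topological_entropy T)%E.
Proof.
apply: shift_entropy_gt0 => N; exists (wlen N); first exact: wlen_gt.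
apply: leq_trans (language_words N); apply: leq_trans (size_words_ge B32 N).
by rewrite leq_exp2l// leq_addr.
Qed.

Lemma grillenberger_not_sensitive : ~ sensitive T.
Proof.
move=> [d d0 /(_ [set x : X | sval x 0%N = None])[]].
- apply: finitary_open; exists 1%N => x y xy /= <-.
  by rewrite (xy 0%N).
- by exists (exist _ _ grillenberger_star).
move=> x [y [n [/= x0 y0' _]]].
have -> : x = y.
  apply: seq_space_inj => i.
  by rewrite (svalP x).2// (svalP y).2.
by rewrite mdistxx ltNge ltW.
Qed.

End grillenberger.


Theorem theorem5p4 (R : realType) :
  exists (X : pmetricType R) (T : X -> X),
    [/\ tds T, uniquely_ergodic T, (0 < topological_entropy T)%E &
        ~ sensitive T].
Proof.
have B32 : (32 <= #|'I_32|)%N by rewrite card_ord.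
exists (seq_space R (grillenberger_star B32 ord0)).
exists (shift_map (@grillenberger_shift _ B32 ord0)).
split.
- exact: grillenberger_tds.
- exact: grillenberger_uniquely_ergodic.
- exact: grillenberger_entropy.
- exact: grillenberger_not_sensitive.
Qed.
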